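(* Let $G$ be a connected finite simple graph, let $M$ be a generalized Laplacian on $G$ with eigenvalues $\lambda_1\le\cdots\le\lambda_n$ (listed with multiplicity, $n=|V_G|$), and suppose that $\lambda_k$ is a simple eigenvalue of $M$ (multiplicity one). Let $\mathbf f_k$ be an eigenvector of $M$ with eigenvalue $\lambda_k$ such that $$\mathrm{Urschel}(\mathbf f_k)=\{v\in V_G : \mathbf f_k(v)=0\}$$ is nonempty, and such that every Urschel vertex of $\mathbf f_k$ is shallow (i.e. $\mathbf f_k$ has no deep Urschel vertices). Then for any vector $\mathbf f_{k,1}\in\mathbb R^{V_G}$ that vanishes at all vertices outside $\mathrm{Urschel}(\mathbf f_k)$, there is a matrix $M_1\in\mathbb R^{V_G\times V_G}$ supported on $G$ such that $$\mathbf f_{k,1}=(M-\lambda_k I)^+M_1\mathbf f_k .$$ In particular, such an $\mathbf f_{k,1}$ can be found with any specified sign pattern on the Urschel vertices of $\mathbf f_k$. Hence $$\mathrm{UN}_{\max}(\mathbf f_k)\le k .$$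
   Context: Graphs $G=(V_G,E_G)$ are finite and simple. A matrix $M\in\mathbb R^{V_G\times V_G}$ is supported on $G$ if $M(u,v)\neq 0$ implies $u=v$ or $\{u,v\}\in E_G$. A generalized Laplacian on $G$ is a symmetric real matrix $M$ supported on $G$ with $M(u,v)<0$ for all $\{u,v\}\in E_G$; its eigenvalues are ordered $\lambda_1\le\lambda_2\le\cdots\le\lambda_n$ with multiplicity. $(\cdot)^+$ denotes the Moore–Penrose pseudoinverse. For a nonzero $\mathbf f:V_G\to\mathbb R$, a vertex $v$ is an Urschel vertex of $\mathbf f$ if $\mathbf f(v)=0$, and a non-Urschel vertex otherwise. An Urschel vertex is shallow if it is adjacent to at least one non-Urschel vertex, and deep otherwise. For $\mathbf f:V_G\to\mathbb R$, a strong nodal domain of $\mathbf f$ is a connected component of the subgraph of $G$ induced on $\{v:\mathbf f(v)>0\}$ or of the subgraph induced on $\{v:\mathbf f(v)<0\}$; $\mathrm{SND}(\mathbf f)$ is the number of strong nodal domains. A signing of $\mathbf f$ is a nowhere-zero function $\tilde{\mathbf f}:V_G\to\mathbb R$ such that $\tilde{\mathbf f}(v)>0$ whenever $\mathbf f(v)>0$ and $\tilde{\mathbf f}(v)<0$ whenever $\mathbf f(v)<0$. The maximum Urschel number is $\mathrm{UN}_{\max}(\mathbf f)=\max\{\mathrm{SND}(\tilde{\mathbf f}) : \tilde{\mathbf f}\text{ is a signing of }\mathbf f\}$. *)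

(* Defs.v *)
From HB Require Import structures.
From mathcomp Require Import all_boot all_order all_algebra.
From mathcomp Require Import boolp reals.

Set Implicit Arguments.
Unset Strict Implicit.
Unset Printing Implicit Defensive.

Import Order.TTheory GRing.Theory Num.Theory.
Local Open Scope ring_scope.

Record sgraph (V : finType) := SGraph {
  adj :> rel V;
  adj_sym : symmetric adj;
  adj_irr : irreflexive adj }.

Definition connected (V : finType) (G : sgraph V) : Prop :=
  forall u v : V, connect G u v.

Definition induced_adj (V : finType) (G : sgraph V) (S : {set V}) : rel V :=
  [rel u v | [&& u \in S, v \in S & G u v]].

Definition components (V : finType) (G : sgraph V) (S : {set V}) :
    {set {set V}} :=
  equivalence_partition (connect (induced_adj G S)) S.

Section Nodal.
Variables (R : realType) (V : finType) (G : sgraph V).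
Implicit Types f g : V -> R.

Definition Urschel f : {set V} := [set v | f v == 0].

Definition shallow f (v : V) : bool :=
  (v \in Urschel f) && [exists u, G v u && (u \notin Urschel f)].

Definition strong_nodal_domains f : {set {set V}} :=
  components G [set v | 0 < f v] :|: components G [set v | f v < 0].

Definition SND f : nat := #|strong_nodal_domains f|.

Definition is_signing f g : Prop :=
  forall v, [/\ g v != 0, 0 < f v -> 0 < g v & f v < 0 -> g v < 0].

Definition signing_SND f : pred nat :=
  fun m => `[< exists2 g, is_signing f g & SND g = m >].

Lemma signing_SND_nonempty f : exists m, signing_SND f m.
Proof.
pose g v : R := if f v < 0 then -1 else 1.
exists (SND g); apply/asboolP; exists g => // v; rewrite /g.
case: ltP => [fv0|fv0]; split=> //; rewrite ?oppr_eq0 ?oner_eq0 ?ltrN10 //.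
by move=> fv1; move: (lt_trans fv0 fv1); rewrite ltxx.
Qed.

Lemma signing_SND_bounded f m : signing_SND f m -> (m <= #|{set V}|)%N.
Proof. by move=> /asboolP[g _ <-]; exact: max_card. Qed.

(** The set of signings is infinite, but the values of [SND] on it form a
    nonempty bounded set of natural numbers, whose maximum [ex_maxn] returns. *)
Definition UNmax f : nat :=
  ex_maxn (signing_SND_nonempty f) (@signing_SND_bounded f).

End Nodal.

Section Matrices.
Variables (R : realType) (n : nat) (G : sgraph 'I_n).
Implicit Types M : 'M[R]_n.

Definition supported M : Prop :=
  forall u v, M u v != 0 -> (u == v) || G u v.

Definition generalized_laplacian M : Prop :=
  [/\ M^T = M, supported M & forall u v, G u v -> M u v < 0].

(** [lam] is the nondecreasing list of the eigenvalues of [M]. For a symmetric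
    real [M] there is exactly one such list, and algebraic and geometric
    multiplicities agree. *)
Definition ordered_eigenvalues M (lam : n.-tuple R) : Prop :=
  sorted <=%R lam /\ char_poly M = \prod_(a <- lam) ('X - a%:P).

End Matrices.

Definition cfun (R : realType) (n : nat) (f : 'cV[R]_n) : 'I_n -> R :=
  fun v => f v 0.

Section MoorePenrose.
Variable R : realType.

Definition penrose m n (A : 'M[R]_(m, n)) (X : 'M[R]_(n, m)) : bool :=
  [&& A *m X *m A == A, X *m A *m X == X,
      (A *m X)^T == A *m X & (X *m A)^T == X *m A].

Lemma mulmx_tr_eq0 m n (u : 'M[R]_(m, n)) : u *m u^T = 0 -> u = 0.
Proof.
move=> uu0; apply/matrixP => i j; rewrite mxE; apply/eqP.
have /matrixP/(_ i i) := uu0; rewrite !mxE => /eqP.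
under eq_bigr do rewrite mxE -expr2.
rewrite psumr_eq0; last by move=> k _; exact: sqr_ge0.
by move=> /allP/(_ j (mem_index_enum _)); rewrite sqrf_eq0.
Qed.

Lemma gram_unitmx m n (F : 'M[R]_(m, n)) :
  row_free F -> F *m F^T \in unitmx.
Proof.
move=> freeF; rewrite -row_free_unit -kermx_eq0; apply/eqP.
set K := kermx _; apply: (row_free_inj freeF); rewrite mul0mx.
apply: mulmx_tr_eq0; rewrite trmx_mul mulmxA -[K *m F *m _]mulmxA.
by rewrite mulmx_ker mul0mx.
Qed.

Lemma penrose_full_rank m n r (C : 'M[R]_(m, r)) (F : 'M[R]_(r, n)) :
  C^T *m C \in unitmx -> F *m F^T \in unitmx ->
  penrose (C *m F) (F^T *m invmx (F *m F^T) *m (invmx (C^T *m C) *m C^T)).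
Proof.
move=> uC uF; set P := invmx (F *m F^T); set Q := invmx (C^T *m C).
have PT : P^T = P by rewrite /P trmx_inv trmx_mul trmxK.
have QT : Q^T = Q by rewrite /Q trmx_inv trmx_mul trmxK.
have FP : F *m (F^T *m P) = 1%:M by rewrite mulmxA mulmxV.
have QC : Q *m C^T *m C = 1%:M by rewrite -mulmxA mulVmx.
have AX : C *m F *m (F^T *m P *m (Q *m C^T)) = C *m (Q *m C^T).
  by rewrite -[C *m F *m _]mulmxA [F *m (_ *m _)]mulmxA FP mul1mx.
have XA : F^T *m P *m (Q *m C^T) *m (C *m F) = F^T *m P *m F.
  by rewrite -mulmxA [Q *m C^T *m _]mulmxA QC mul1mx.
apply/and4P; split; apply/eqP.
- by rewrite AX mulmxA -[C *m _ *m C]mulmxA QC mulmx1.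
- by rewrite XA mulmxA -[F^T *m P *m F *m _]mulmxA FP mulmx1.
- by rewrite AX !trmx_mul trmxK QT mulmxA.
- by rewrite XA !trmx_mul trmxK PT mulmxA.
Qed.

Lemma penrose_exists m n (A : 'M[R]_(m, n)) : exists X, penrose A X.
Proof.
have uF := gram_unitmx (row_base_free A).
have uC : (col_base A)^T *m col_base A \in unitmx.
  rewrite -{2}[col_base A]trmxK; apply: gram_unitmx.
  by rewrite /row_free mxrank_tr; exact: (col_base_full A).
have := penrose_full_rank uC uF; rewrite mulmx_base => AX.
by eexists; exact: AX.
Qed.

Definition mpinv m n (A : 'M[R]_(m, n)) : 'M[R]_(n, m) :=
  xchoose (penrose_exists A).

Lemma mpinvP m n (A : 'M[R]_(m, n)) : penrose A (mpinv A).
Proof. exact: xchooseP. Qed.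

Lemma penrose_uniq m n (A : 'M[R]_(m, n)) X : penrose A X -> X = mpinv A.
Proof.
have := mpinvP A; move: (mpinv A) => Y.
move=> /and4P[/eqP AYA /eqP YAY /eqP AYs /eqP YAs].
move=> /and4P[/eqP AXA /eqP XAX /eqP AXs /eqP XAs].
have AXY : A *m X = A *m Y.
  rewrite -AXs -{1}AYA -[_ *m A *m X]mulmxA trmx_mul AXs AYs.
  by rewrite mulmxA AXA.
have XYA : X *m A = Y *m A.
  rewrite -XAs -{1}AYA -[_ *m A]mulmxA mulmxA trmx_mul XAs YAs.
  by rewrite -mulmxA [A *m (X *m A)]mulmxA AXA.
by rewrite -XAX XYA -mulmxA AXY mulmxA YAY.
Qed.

End MoorePenrose.

(* Main.v *)
Require Import Defs.
From HB Require Import structures.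
From mathcomp Require Import all_boot all_order all_algebra.
From mathcomp Require Import boolp reals.
From mathcomp Require Import ring lra.

Set Implicit Arguments.
Unset Strict Implicit.
Unset Printing Implicit Defensive.

Import Order.TTheory GRing.Theory Num.Theory.
Local Open Scope ring_scope.

(** Write [l] for [lambda_k] and [A] for [M - l]. Since [l] is simple, [A^+ A] is
    the orthogonal projection off the line of [f], and it fixes every [f1] supported
    on the zeros of [f]; so it suffices that [M1 f = A f1], which can be solved row
    by row because every vertex has a non-Urschel vertex in its closed neighbourhood.

    For the bound on signings, the same device in symmetric form (off-diagonal
    entries on the edge from each Urschel vertex to a chosen non-Urschel neighbour,
    corrected on the diagonal) gives a symmetric [E = O(eps)] supported on [G] with
    [(A + E) (f + eps f1) = 0]. If [f1] has the signs of a signing [g], then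
    [f + eps f1] is nowhere zero with the signs of [g], and as in Courant's theorem
    the form of [A + E] is nonpositive on the span of its restrictions to its nodal
    domains. But [A] is at least [delta > 0] on a space of codimension [k], where
    [A + E] remains positive for small [eps]; hence there are at most [k] domains. *)

(** * Diagonalization of symmetric matrices and counting of eigenvalues *)

(** For symmetric [C], [C ^+ 2 = C *m C^T], so [C ^+ 2 = 0] forces [C = 0]. Raising the exponent to
    a power of two lets this halve it down to 1. *)
Lemma symmetric_exp_eq0 (R : realType) n (B : 'M[R]_n.+1) m :
  B^T = B -> B ^+ m = 0 -> B = 0.
Proof.
move=> Bs; have BXs j : (B ^+ j)^T = B ^+ j.
  elim: j => [|j IHj]; first by rewrite expr0 trmx1.
  by rewrite {1}exprS -mulmxE trmx_mul IHj Bs mulmxE -exprSr.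
suff H j : B ^+ (2 ^ j) = 0 -> B = 0.
  move=> Bm; apply: (H m).
  by rewrite -(subnK (ltnW (ltn_expl m (ltnSn 1)))) exprD Bm mulr0.
elim: j => [|j IHj] //; rewrite expnS mulSn mul1n exprD -{2}BXs.
by move=> /mulmx_tr_eq0/IHj.
Qed.

Lemma horner_mx_tr (R : comNzRingType) n (A : 'M[R]_n.+1) p :
  (horner_mx A p)^T = horner_mx A^T p.
Proof.
elim/poly_ind: p => [|p c IHp]; first by rewrite !rmorph0 trmx0.
rewrite !rmorphD !rmorphM /= !horner_mx_X !horner_mx_C linearD /= tr_scalar_mx.
by rewrite trmx_mul IHp (comm_mx_horner p (comm_mx_refl A^T)).
Qed.

Lemma char_poly_uconj (F : fieldType) n (P A B : 'M[F]_n) :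
  P \in unitmx -> P *m A = B *m P -> char_poly A = char_poly B.
Proof.
move=> uP PA; rewrite /char_poly /char_poly_mx.
have uPX : \det (map_mx polyC P) != 0.
  by rewrite det_map_mx polyC_eq0 -unitfE -unitmxE.
apply: (mulfI uPX); rewrite -det_mulmx mulrC -det_mulmx; congr (\det _).
by rewrite mulmxBl mulmxBr -!map_mxM PA scalar_mxC.
Qed.

(* A symmetric matrix has no nontrivial nilpotent polynomial expression, so the
   product of the distinct linear factors of its characteristic polynomial
   already annihilates it. *)
Lemma symmetric_diagonalization (R : realType) n (M : 'M[R]_n.+1) (lam : seq R) :
  M^T = M -> char_poly M = \prod_(a <- lam) ('X - a%:P) ->
  exists (P : 'M[R]_n.+1) (d : 'rV[R]_n.+1),
    [/\ P \in unitmx, P *m M = diag_mx d *m P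
      & perm_eq [seq d 0 i | i <- enum 'I_n.+1] lam].
Proof.
move=> Ms Mlam.
have /diagonalizableP : exists2 rs, uniq rs &
    mxminpoly M %| \prod_(x <- rs) ('X - x%:P).
  exists (undup lam); first exact: undup_uniq.
  apply: mxminpoly_min; set q := \prod_(x <- _) _.
  apply: (@symmetric_exp_eq0 _ _ _ (size lam)); first by rewrite horner_mx_tr Ms.
  rewrite -rmorphXn /=.
  (* Each of the [size lam] linear factors of the characteristic polynomial divides [q], hence their
     product divides [q ^+ size lam]. *)
  have /dvdpP[r ->] : char_poly M %| q ^+ size lam.
    rewrite Mlam (big_nth 0) big_mkord -[X in q ^+ X]card_ord -prodr_const.
    apply: (big_ind2 (fun a b => a %| b)) => [|a b c e ab ce|i _].
    - exact: dvdpp.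
    - exact: dvdp_mul.
    by rewrite dvdp_XsubCl root_prod_XsubC mem_undup mem_nth.
  by rewrite rmorphM /= Cayley_Hamilton mulr0.
case=> P uP /diagonalizable_forPex[d /(simmxP uP) PM]; exists P, d; split => //.
apply: prod_XsubC_eq; rewrite -Mlam (char_poly_uconj uP PM).
rewrite char_poly_trig ?diag_mx_is_trig // big_map big_enum.
by apply: eq_bigr => i _; rewrite mxE eqxx.
Qed.

(** By sortedness every entry after index [k.-1] is at least the one there, and equality would give
    a second occurrence. So only the first [k] entries are counted. *)
Lemma count_le_simple (R : realType) (lam : seq R) k :
  (0 < k <= size lam)%N -> sorted <=%R lam ->
  count_mem (lam`_k.-1) lam = 1%N -> (count (<= lam`_k.-1)%R lam <= k)%N.
Proof.
case: k => [|k] //= klam; set a := lam`_k => slam ca.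
have E : lam = take k lam ++ a :: drop k.+1 lam by rewrite -drop_nth ?cat_take_drop.
move: slam ca; rewrite {1 2 3}E => slam.
have /andP[_] : sorted <=%R (take k lam) && sorted <=%R (a :: drop k.+1 lam).
  by move: slam; rewrite !(sorted_pairwise le_trans) pairwise_cat => /and3P[_ -> ->].
rewrite /= path_sortedE; last exact: le_trans.
case/andP => /allP le_a _; rewrite !count_cat /= eqxx lexx => ca.
have -> : count (<= a) (drop k.+1 lam) = 0%N.
  apply/eqP; rewrite -leqn0 leqNgt -has_count; apply/hasP => -[x xin /= xa].
  have xE : x = a by apply/eqP; rewrite eq_le xa le_a.
  move: xin; rewrite xE -has_pred1 has_count; move: ca.
  by rewrite addnC -addnA add1n => -[/eqP]; rewrite addn_eq0 => /andP[/eqP ->].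
rewrite addn0 addn1 ltnS (leq_trans (count_size _ _)) // size_take.
by case: ltnP => // /ltnW.
Qed.

(** * Quadratic forms and the spectral gap *)

Lemma fin_lower_bound (R : realType) (I : finType) (P : pred I) (F : I -> R) :
  (forall i, P i -> 0 < F i) ->
  exists2 c, 0 < c & forall i, P i -> c <= F i.
Proof.
(* The default 1 keeps the minimum positive even when no index satisfies [P]. *)
move=> F_gt0; exists (\big[Order.min/1]_(i | P i) F i).
  by apply: lt_bigmin.
by move=> i Pi; apply: bigmin_le_cond.
Qed.

Lemma fin_upper_bound (R : realType) (I : finType) (F : I -> R) :
  exists2 c, 0 < c & forall i, F i <= c.
Proof.
exists (\big[Order.max/1]_i F i); last by move=> i; apply: le_bigmax.
by apply: (lt_le_trans ltr01); apply: bigmax_ge_id.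
Qed.

Section QuadraticForms.
Variables (R : realType) (n : nat).
Implicit Types (A : 'M[R]_n) (x : 'rV[R]_n).

Definition qform A x : R := (x *m A *m x^T) 0 0.

Lemma qformE A x : qform A x = \sum_u \sum_v x 0 u * A u v * x 0 v.
Proof.
rewrite /qform mxE exchange_big; apply: eq_bigr => v _; rewrite !mxE big_distrl.
by [].
Qed.

Lemma qformD A B x : qform (A + B) x = qform A x + qform B x.
Proof. by rewrite /qform mulmxDr mulmxDl mxE. Qed.

Lemma qform_scalar a x : qform a%:M x = a * qform 1%:M x.
Proof. by rewrite /qform mul_mx_scalar mulmx1 -scalemxAl mxE. Qed.

Lemma qform1E x : qform 1%:M x = \sum_u x 0 u ^+ 2.
Proof. by rewrite /qform mulmx1 mxE; apply: eq_bigr => u _; rewrite mxE expr2. Qed.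

Lemma qform1_ge0 x : 0 <= qform 1%:M x.
Proof. by rewrite qform1E sumr_ge0 // => u _; apply: sqr_ge0. Qed.

Lemma qform1_gt0 x : x != 0 -> 0 < qform 1%:M x.
Proof.
move=> x0; rewrite lt_neqAle qform1_ge0 andbT eq_sym; apply: contra x0 => /eqP q0.
apply/eqP/mulmx_tr_eq0/matrixP => i j; rewrite !ord1 [RHS]mxE -q0.
by rewrite /qform mulmx1.
Qed.

(** Each term is at most [c * (x 0 u ^+ 2 + x 0 v ^+ 2) / 2] by the arithmetic-geometric mean
    inequality; summing over all pairs produces the factor [n]. *)
Lemma qform_abs_le A x c : (forall u v, `|A u v| <= c) ->
  `|qform A x| <= n%:R * c * qform 1%:M x.
Proof.
move=> Ac; rewrite qformE (le_trans (ler_norm_sum _ _ _)) //.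
have -> : n%:R * c * qform 1%:M x =
    \sum_u \sum_v c * (x 0 u ^+ 2 + x 0 v ^+ 2) / 2.
  rewrite qform1E; pose S := \sum_u x 0 u ^+ 2; rewrite -/S.
  transitivity (\sum_(u < n) (c * x 0 u ^+ 2 / 2 * n%:R + c * S / 2)).
    rewrite big_split /= sumr_const card_ord -[_ *+ n]mulr_natr -!mulr_suml -mulr_sumr.
    by rewrite -/S; field.
  apply: eq_bigr => u _; rewrite -mulr_suml -mulr_sumr big_split /= sumr_const.
  by rewrite card_ord -[_ *+ n]mulr_natr -/S; field.
apply: ler_sum => u _; rewrite (le_trans (ler_norm_sum _ _ _)) //.
apply: ler_sum => v _; rewrite !normrM.
have c0 : 0 <= c := le_trans (normr_ge0 _) (Ac u v).
apply: (@le_trans _ _ (`|x 0 u| * c * `|x 0 v|)).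
  by rewrite ler_wpM2r // ler_wpM2l.
rewrite -[x 0 u ^+ 2]real_normK ?num_real // -[x 0 v ^+ 2]real_normK ?num_real //.
have := mulr_ge0 c0 (sqr_ge0 (`|x 0 u| - `|x 0 v|)); lra.
Qed.

End QuadraticForms.

(* With [P M = D P], the Gram matrix [K = P P^T] commutes with [D]; hence for
   [x = c P] with [c] supported where [D >= l + delta] one gets
   [x (M - l - delta) x^T = c (D - l - delta) K c^T = (c S) K (c S)^T >= 0],
   where [S] is the square root of the positive part of [D - l - delta]. *)
Lemma spectral_gap (R : realType) n (M : 'M[R]_n.+1) (lam : seq R) (l : R) :
  M^T = M -> char_poly M = \prod_(a <- lam) ('X - a%:P) ->
  exists (m : nat) (Q : 'M[R]_(n.+1, m)) (delta : R),
    [/\ m = count (<= l) lam, 0 < delta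
      & forall x, x *m Q = 0 -> (l + delta) * qform 1%:M x <= qform M x].
Proof.
move=> Msym Mlam.
have [P [d [uP PM dlam]]] := symmetric_diagonalization Msym Mlam.
have [delta delta0 gap] : exists2 c, 0 < c &
    forall i, l < d 0 i -> c <= d 0 i - l.
  by apply: fin_lower_bound => i; rewrite subr_gt0.
pose S := [set i | d 0 i <= l].
(* The columns of [Q] read off the eigenbasis coordinates of [x] with eigenvalue at most [l], so
   [x *m Q = 0] kills exactly these. *)
exists #|S|, (colsub (@enum_val _ (mem S)) (invmx P)), delta; split => //.
  rewrite -(permP dlam) count_map cardE size_filter enumT.
  by apply: eq_count => i; rewrite /= inE.
move=> x xQ; set c := x *m invmx P.
have xE : x = c *m P by rewrite /c mulmxKV.
have c0 i : d 0 i <= l -> c 0 i = 0.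
  move=> il; have iS : i \in S by rewrite inE.
  have := congr1 (fun A : 'M_(_, _) => A 0 (enum_rank_in iS i)) xQ.
  rewrite mxE [RHS]mxE => xQ0; rewrite /c mxE -[RHS]xQ0; apply: eq_bigr => j _.
  by rewrite mxE enum_rankK_in.
set K := P *m P^T.
have KD : K *m diag_mx d = diag_mx d *m K.
  rewrite /K [RHS]mulmxA -PM -(tr_diag_mx d) -mulmxA -trmx_mul -PM trmx_mul.
  by rewrite Msym mulmxA.
have K0 i j : d 0 i != d 0 j -> K i j = 0.
  move=> dij; have := congr1 (fun A : 'M_(_, _) => A i j) KD.
  rewrite mul_mx_diag mul_diag_mx !mxE => /eqP; rewrite mulrC -subr_eq0 -mulrBl.
  by rewrite mulf_eq0 subr_eq0 eq_sym (negPf dij) => /eqP.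
pose s i := Num.sqrt (d 0 i - (l + delta)).
suff -> : qform M x = (l + delta) * qform 1%:M x
    + qform 1%:M ((\row_i (c 0 i * s i)) *m P) by rewrite lerDl qform1_ge0.
have qP A (y : 'rV_n.+1) : qform A (y *m P) = qform (P *m A *m P^T) y.
  by rewrite /qform trmx_mul !mulmxA.
rewrite {1 2}xE !qP !mulmx1 PM -mulmxA -/K !qformE mulr_sumr -big_split /=.
clearbody c K.
apply: eq_bigr => i _; rewrite mulr_sumr -big_split; apply: eq_bigr => j _ /=.
rewrite mul_diag_mx !mxE.
(* [K] couples only equal eigenvalues, and [c] vanishes where [d 0 i <= l]; on the remaining pairs
   [s i * s j] is a genuine square root squared. *)
have [->|Kij0] := eqVneq (K i j) 0; first by rewrite !(mulr0, mul0r) addr0.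
have dij : d 0 i = d 0 j by apply/eqP; apply: contraR Kij0 => /K0 ->.
have [il|li] := leP (d 0 i) l; first by rewrite (c0 i il) !(mulr0, mul0r) addr0.
have sij : s i * s j = d 0 i - (l + delta).
  rewrite /s -dij -expr2 sqr_sqrtr //; have := gap i li; lra.
transitivity ((l + delta) * (c 0 i * K i j * c 0 j)
  + c 0 i * (s i * s j) * K i j * c 0 j); last by ring.
by rewrite sij; ring.
Qed.

(** * Nodal domains *)

Section Components.
Variables (V : finType) (G : sgraph V).

Lemma connect_induced_equiv (S : {set V}) :
  {in S & &, equivalence_rel (connect (induced_adj G S))}.
Proof.
have sym : connect_sym (induced_adj G S).
  by apply: sym_connect_sym => u v; rewrite /induced_adj /= andbCA adj_sym.
by move=> u v w _ _ _; split=> [|uv]; [exact: connect0 | exact: same_connect].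
Qed.

Lemma component_partition (S : {set V}) : partition (components G S) S.
Proof. exact/equivalence_partitionP/connect_induced_equiv. Qed.

Lemma component_adj (S : {set V}) D u v :
  D \in components G S -> u \in D -> v \in S -> G u v -> v \in D.
Proof.
move=> DS uD vS uv; have /and3P[/eqP covS triv _] := component_partition S.
have uS : u \in S by rewrite -covS; apply/bigcupP; exists D.
rewrite -(def_pblock triv DS uD).
rewrite (pblock_equivalence_partition (@connect_induced_equiv S)) //.
by apply: connect1; rewrite /induced_adj /= uS vS.
Qed.

End Components.

Section NodalDomains.
Variables (R : realType) (V : finType) (G : sgraph V) (g : V -> R).

(** Comparing signs with [g v] treats positive and negative domains uniformly. *)
Lemma nodal_domain_component D v : D \in strong_nodal_domains G g -> v \in D ->
  D \in components G [set w | 0 < g v * g w].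
Proof.
suff key (S : {set V}) : (v \in S -> S = [set w | 0 < g v * g w]) ->
    D \in components G S -> v \in D -> D \in components G [set w | 0 < g v * g w].
  rewrite inE => /orP[]; apply: key; rewrite inE => gv; apply/setP => w.
    by rewrite !inE pmulr_rgt0.
  by rewrite !inE nmulr_rgt0.
move=> SE DS vD; rewrite -SE //.
have /and3P[/eqP <- _ _] := @component_partition _ G S.
by apply/bigcupP; exists D.
Qed.

Lemma nodal_domain_neq0 D : D \in strong_nodal_domains G g -> exists v, v \in D.
Proof.
move=> DP; apply/set0Pn; apply: contraTneq DP => ->; rewrite inE negb_or.
by have /and3P[_ _ ->] := @component_partition _ G [set w | 0 < g w];
  have /and3P[_ _ ->] := @component_partition _ G [set w | g w < 0].
Qed.

Lemma nodal_domain_uniq D D' v : D \in strong_nodal_domains G g ->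
  D' \in strong_nodal_domains G g -> v \in D -> v \in D' -> D = D'.
Proof.
move=> DP DP' vD vD'; have /and3P[_ triv _] :=
  @component_partition _ G [set w | 0 < g v * g w].
rewrite -(def_pblock triv (nodal_domain_component DP vD) vD).
by rewrite -(def_pblock triv (nodal_domain_component DP' vD') vD').
Qed.

Lemma nodal_domain_adj D u v : D \in strong_nodal_domains G g ->
  G u v -> 0 < g u * g v -> (u \in D) = (v \in D).
Proof.
have imp a b : D \in strong_nodal_domains G g -> G a b -> 0 < g a * g b ->
    a \in D -> b \in D.
  move=> DP ab gab aD; apply: (component_adj (nodal_domain_component DP aD) aD) => //.
  by rewrite inE.
move=> DP uv guv; apply/idP/idP; apply: imp => //; first by rewrite adj_sym.
by rewrite mulrC.
Qed.

End NodalDomains.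

(* For [x = alpha h], the identity
   [x N x^T = - 1/2 \sum_(u, v) (alpha u - alpha v)^2 h u N_uv h v], valid because
   [N h = 0], has only nonpositive terms when [alpha] is constant on nodal domains:
   [N_uv <= 0], and [h u h v < 0] along an edge joining two nodal domains. *)
Lemma nodal_domains_nonpos (R : realType) n (G : sgraph 'I_n) (N : 'M[R]_n)
    (h : 'cV[R]_n) :
  N^T = N -> (forall u v, u != v -> N u v <= 0) -> supported G N ->
  N *m h = 0 -> (forall v, h v 0 != 0) ->
  exists2 H : 'M[R]_(SND G (cfun h), n), row_free H &
    forall a, qform N (a *m H) <= 0.
Proof.
move=> Ns N_le0 N_supp Nh h0; set P := strong_nodal_domains G (cfun h).
pose D (i : 'I_#|P|) := enum_val i; have DP i : D i \in P := enum_valP i.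
exists (\matrix_(i < #|P|, v < n) ((v \in D i)%:R * h v 0)).
  apply/inj_row_free => a aH0; apply/rowP => i; rewrite [RHS]mxE.
  have [v vDi] := nodal_domain_neq0 (DP i).
  have := congr1 (fun A : 'rV_n => A 0 v) aH0.
  rewrite mxE [RHS]mxE (bigD1 i) //= big1 => [|j ji].
    by rewrite mxE vDi mul1r addr0 => /eqP; rewrite mulf_eq0 (negPf (h0 v)) orbF => /eqP.
  rewrite mxE; case vDj: (v \in D j); last by rewrite mul0r mulr0.
  by move: ji; rewrite (enum_val_inj (nodal_domain_uniq (DP j) (DP i) vDj vDi)) eqxx.
move=> a; set x := a *m _; pose al v := \sum_i a 0 i * (v \in D i)%:R.
have xE v : x 0 v = al v * h v 0.
  by rewrite mxE big_distrl; apply: eq_bigr => i _; rewrite mxE mulrA.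
pose c u v := h u 0 * N u v * h v 0.
have c_sym u v : c u v = c v u by rewrite /c -{1}Ns mxE; ring.
have c_sum u : \sum_v c u v = 0.
  have := congr1 (fun A : 'cV_n => A u 0) Nh; rewrite mxE [RHS]mxE => Nhu.
  transitivity (h u 0 * (\sum_v N u v * h v 0)); last by rewrite Nhu mulr0.
  by rewrite mulr_sumr; apply: eq_bigr => v _; rewrite /c mulrA.
pose T := \sum_u \sum_v (al u - al v) ^+ 2 * c u v.
have T_ge0 : 0 <= T.
  apply: sumr_ge0 => u _; apply: sumr_ge0 => v _.
  have [->|uv] := eqVneq u v; first by rewrite subrr expr0n mul0r.
  have [Nuv0|Nuv] := eqVneq (N u v) 0; first by rewrite /c Nuv0 mulr0 mul0r mulr0.
  have uvG : G u v by have := N_supp u v Nuv; rewrite (negPf uv).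
  have [huv|huv] := ltP 0 (h u 0 * h v 0).
    suff -> : al u = al v by rewrite subrr expr0n mul0r.
    apply: eq_bigr => i _.
    by rewrite (nodal_domain_adj (DP i) uvG huv).
  rewrite mulr_ge0 ?sqr_ge0 // /c mulrAC mulr_le0 ?N_le0 //.
(* Expand the square in [T]: both pure square terms vanish because the rows and columns of [c] sum
   to 0, and the cross term is [- 2 * qform N x]. *)
have qE : qform N x + qform N x + T = 0.
  have S0 : \sum_u \sum_v al u ^+ 2 * c u v = 0.
    by apply: big1 => u _; rewrite -big_distrr /= c_sum mulr0.
  have S1 : \sum_u \sum_v al v ^+ 2 * c u v = 0.
    rewrite exchange_big /=; apply: big1 => v _; rewrite -big_distrr /=.
    by under eq_bigr do rewrite c_sym; rewrite c_sum mulr0.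
  transitivity (\sum_u \sum_v al u ^+ 2 * c u v + \sum_u \sum_v al v ^+ 2 * c u v);
    last by rewrite S0 S1 addr0.
  rewrite qformE /T -!big_split; apply: eq_bigr => u _ /=.
  rewrite -!big_split; apply: eq_bigr => v _ /=; rewrite !xE /c; ring.
lra.
Qed.

(** * Perturbation *)

(** With [E = eps F] and [h = f + eps f1], it suffices that [F h = - A f1], since [A h = eps A f1].
    The bound [B] must not depend on [eps], so that [eps] can be chosen after it. *)
Lemma supported_sym_perturbation (R : realType) n (G : sgraph 'I_n)
    (A : 'M[R]_n) (f f1 : 'cV[R]_n) :
  A *m f = 0 ->
  (forall v, v \in Urschel (cfun f) -> shallow G (cfun f) v) ->
  (forall v, v \notin Urschel (cfun f) -> f1 v 0 = 0) ->
  exists2 B, 0 < B & forall eps, 0 < eps <= 1 ->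
    exists E : 'M[R]_n, [/\ E^T = E, supported G E,
      forall u v, `|E u v| <= eps * B & (A + E) *m (f + eps *: f1) = 0].
Proof.
move=> Af shal f10; pose r := - (A *m f1).
have /fin_all_exists[p pP] v : exists u, f v 0 = 0 -> G v u /\ f u 0 != 0.
  have [fv0|fv0] := eqVneq (f v 0) 0; last first.
    by exists v => fv; rewrite fv eqxx in fv0.
  have := shal v; rewrite /shallow !inE /cfun fv0 eqxx => /(_ isT)/existsP[u].
  by rewrite inE => /andP[vu fu]; exists u.
have f10' v : f v 0 != 0 -> f1 v 0 = 0 by move=> fv; apply: f10; rewrite inE.
(* For an Urschel vertex [u], [h] agrees with [f] at [p u], so the single entry [r u / f (p u)]
   solves row [u]; the second summand symmetrizes. *)
pose F0 u v : R := (if (f u 0 == 0) && (v == p u) then r u 0 / f v 0 else 0)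
  + (if (f v 0 == 0) && (u == p v) then r v 0 / f u 0 else 0).
have F0_sym u v : F0 u v = F0 v u by rewrite /F0 addrC.
have F0_Urschel u v : f u 0 = 0 -> F0 u v = if v == p u then r u 0 / f v 0 else 0.
  move=> fu; rewrite /F0 fu eqxx /= [X in _ + X](_ : _ = 0) ?addr0 //.
  case: eqP => //= fv; case: eqP => // uE.
  by have [_] := pP v fv; rewrite -uE fu eqxx.
have F0_supp u v : F0 u v != 0 -> G u v.
  have imp a b : f a 0 = 0 -> F0 a b != 0 -> G a b.
    move=> fa; rewrite F0_Urschel //; case: (b =P p a) => [-> _|_].
      by case: (pP a fa).
    by rewrite eqxx.
  have [fu|fu] := eqVneq (f u 0) 0; first exact: imp.
  have [fv|fv] := eqVneq (f v 0) 0; first by rewrite F0_sym adj_sym; exact: imp.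
  by rewrite /F0 (negPf fu) (negPf fv) addr0 eqxx.
(* [b] bounds the diagonal correction [F1] for all [eps <= 1], as then [|h| <= |f| + |f1|]
   entrywise. *)
pose b u := (`|r u 0| + \sum_v `|F0 u v| * (`|f v 0| + `|f1 v 0|)) / `|f u 0|.
have [B B0 FB] := fin_upper_bound (fun uv : 'I_n * 'I_n => `|F0 uv.1 uv.2| + b uv.1).
exists B => // eps /andP[eps0 eps1]; pose h := f + eps *: f1.
(* Division by zero gives 0, so rows of Urschel vertices, already solved, are left alone; in the
   other rows [h = f]. *)
pose F1 := \row_u ((r u 0 - \sum_v F0 u v * h v 0) / f u 0).
have b_ge0 u : 0 <= b u.
  apply: divr_ge0 => //; rewrite addr_ge0 // sumr_ge0 // => v _.
  by rewrite mulr_ge0 ?addr_ge0.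
have F1b u : `|F1 0 u| <= b u.
  rewrite mxE normrM normfV ler_wpM2r ?invr_ge0 // (le_trans (ler_normB _ _)) //.
  rewrite lerD2l (le_trans (ler_norm_sum _ _ _)) //; apply: ler_sum => v _.
  rewrite normrM ler_wpM2l // !mxE (le_trans (ler_normD _ _)) // lerD2l normrM.
  by rewrite gtr0_norm // ler_piMl.
exists (eps *: (\matrix_(u, v) F0 u v + diag_mx F1)); split.
- rewrite linearZ linearD /= tr_diag_mx; congr (_ *: (_ + _)).
  by apply/matrixP => u v; rewrite !mxE F0_sym.
- move=> u v; rewrite mxE; case: (eqVneq u v) => //= uv.
  rewrite mulf_eq0 negb_or => /andP[_].
  by rewrite !mxE (negPf uv) mulr0n addr0 => /F0_supp.
- move=> u v; rewrite mxE normrM gtr0_norm // ler_pM2l //.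
  apply: le_trans (FB (u, v)); rewrite 3!mxE (le_trans (ler_normD _ _)) // lerD2l.
  by case: (u == v); rewrite ?mulr1n ?mulr0n ?normr0.
have Fh : (\matrix_(u, v) F0 u v + diag_mx F1) *m h = r.
  apply/colP => u; rewrite mulmxDl mul_diag_mx 3!mxE.
  under eq_bigr do rewrite mxE.
  have [fu|fu] := eqVneq (f u 0) 0; last first.
    have -> : h u 0 = f u 0 by rewrite !mxE f10' // mulr0 addr0.
    by rewrite mxE divfK // addrC subrK.
  rewrite mxE fu invr0 mulr0 mul0r addr0 (bigD1 (p u)) //= big1 => [|v vp].
    have [_ fp] := pP u fu.
    by rewrite F0_Urschel // eqxx addr0 !mxE f10' // mulr0 addr0 divfK.
  by rewrite F0_Urschel // (negPf vp) mul0r.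
rewrite -/h mulmxDl -scalemxAl Fh /r /h mulmxDr Af add0r -scalemxAr scalerN.
by rewrite subrr.
Qed.

(** * Prescribed images and the pseudoinverse *)

(** Row [v] needs only one entry, [g v / f (p v)], at a vertex [p v] of the closed neighbourhood of
    [v] where [f] is nonzero. *)
Lemma supported_mul (R : realType) n (G : sgraph 'I_n) (f g : 'cV[R]_n) :
  (forall v, v \in Urschel (cfun f) -> shallow G (cfun f) v) ->
  exists2 M1 : 'M[R]_n, supported G M1 & M1 *m f = g.
Proof.
move=> shal.
have /fin_all_exists[p pP] v : exists u, ((v == u) || G v u) /\ f u 0 != 0.
  have [fv|] := boolP (v \in Urschel (cfun f)); last first.
    by rewrite inE => fv; exists v; rewrite eqxx.
  have /andP[_ /existsP[u]] := shal v fv.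
  by rewrite inE => /andP[vu fu]; exists u; rewrite vu orbT.
exists (\matrix_(v, u) if u == p v then g v 0 / f u 0 else 0).
  move=> v u; rewrite mxE; case: (u =P p v) => [-> _|_]; last by rewrite eqxx.
  by case: (pP v).
apply/colP => v; rewrite mxE (bigD1 (p v)) //= big1 => [|u up].
  by rewrite mxE eqxx addr0 divfK //; case: (pP v).
by rewrite mxE (negPf up) mul0r.
Qed.

(** In eigenbasis coordinates an eigenvector for [l] lives on the indices with [d 0 i = l], and
    simplicity leaves just one, [i0]. *)
Lemma simple_eigenvector (R : realType) n (M : 'M[R]_n.+1) (lam : seq R) (l : R)
    (f y : 'cV[R]_n.+1) :
  M^T = M -> char_poly M = \prod_(a <- lam) ('X - a%:P) ->
  count_mem l lam = 1%N -> f != 0 -> M *m f = l *: f -> M *m y = l *: y ->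
  exists a, y = a *: f.
Proof.
move=> Ms Mlam cl f0 Mf My.
have [P [d [uP PM dlam]]] := symmetric_diagonalization Ms Mlam.
have coord0 (z : 'cV_n.+1) i : M *m z = l *: z -> d 0 i != l -> (P *m z) i 0 = 0.
  move=> Mz dil; have : P *m M *m z = l *: (P *m z) by rewrite -mulmxA Mz scalemxAr.
  rewrite PM -mulmxA => /colP/(_ i); rewrite mul_diag_mx [LHS]mxE [RHS]mxE => /eqP.
  by rewrite -subr_eq0 -mulrBl mulf_eq0 subr_eq0 (negPf dil) => /eqP.
have /card1P[i0 i0P] : #|[pred i | d 0 i == l]| == 1%N.
  apply/eqP; rewrite -[RHS]cl -(permP dlam) count_map cardE size_filter enumT.
  exact: eq_count.
have Pz (z : 'cV_n.+1) i : M *m z = l *: z -> (P *m z) i 0 = (P *m z) i0 0 *+ (i == i0).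
  move=> Mz; case: eqVneq => [->//|ii0]; rewrite mulr0n; apply: coord0 => //.
  by have := i0P i; rewrite !inE (negPf ii0) => ->.
have Pf0 : (P *m f) i0 0 != 0.
  apply: contra f0 => /eqP Pf0; rewrite -(mulKmx uP f) (_ : P *m f = 0) ?mulmx0 //.
  by apply/colP => i; rewrite Pz // Pf0 mul0rn mxE.
exists ((P *m y) i0 0 / (P *m f) i0 0).
apply: (can_inj (mulKmx uP)); rewrite -scalemxAr.
by apply/colP => i; rewrite (Pz y i) // [RHS]mxE (Pz f i) // mulrnAr divfK.
Qed.

(** The defect [y] lies in the kernel of [A], hence on the line of [f]. It is also orthogonal to
    [f], because [X *m A] is symmetric and kills [f]; so [y = 0]. *)
Lemma mpinv_mulK (R : realType) n (A : 'M[R]_n) (f g : 'cV[R]_n) :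
  A *m f = 0 -> (forall y : 'cV_n, A *m y = 0 -> exists a, y = a *: f) ->
  f^T *m g = 0 -> mpinv A *m (A *m g) = g.
Proof.
move=> Af kerA fg.
have /and4P[/eqP AXA _ _ /eqP XAs] := mpinvP A; set X := mpinv A in AXA XAs *.
pose y := g - X *m (A *m g).
have [a ya] : exists a, y = a *: f.
  by apply: kerA; rewrite mulmxBr !mulmxA AXA subrr.
have fy : f^T *m y = 0.
  rewrite mulmxBr fg [X *m _]mulmxA mulmxA -XAs -trmx_mul -mulmxA Af.
  by rewrite mulmx0 trmx0 mul0mx subrr.
suff y0 : y = 0 by rewrite -[RHS]subr0 -y0 /y opprB addrC subrK.
apply: trmx_inj; rewrite trmx0; apply: mulmx_tr_eq0.
by rewrite trmxK {1}ya linearZ /= -scalemxAl fy scaler0.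
Qed.

(** * Bound on the nodal domains of a signing *)

Lemma signing_SND_le (R : realType) n (G : sgraph 'I_n.+1) (M : 'M[R]_n.+1)
    (lam : seq R) (l : R) (f : 'cV[R]_n.+1) (g : 'I_n.+1 -> R) :
  generalized_laplacian G M -> char_poly M = \prod_(a <- lam) ('X - a%:P) ->
  M *m f = l *: f ->
  (forall v, v \in Urschel (cfun f) -> shallow G (cfun f) v) ->
  is_signing (cfun f) g -> (SND G g <= count (<= l)%R lam)%N.
Proof.
move=> [Ms Msupp Mneg] Mlam Mf shal gf.
have [m [Q [delta [mE delta0 gap]]]] := spectral_gap l Ms Mlam.
pose A := M - l%:M.
have Af : A *m f = 0 by rewrite mulmxBl Mf mul_scalar_mx subrr.
pose f1 := \col_v if f v 0 == 0 then g v else 0.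
have f10 v : v \notin Urschel (cfun f) -> f1 v 0 = 0.
  by rewrite inE mxE /cfun => /negPf ->.
have [B B0 pert] := supported_sym_perturbation Af shal f10.
have [c c0 cM] : exists2 c, 0 < c &
    forall uv : 'I_n.+1 * 'I_n.+1, G uv.1 uv.2 -> c <= - M uv.1 uv.2.
  by apply: fin_lower_bound => uv /Mneg; rewrite oppr_gt0.
(* [gam <= c] keeps the edge entries of [A + E] nonpositive. The other bound puts the form of [E],
   at most [n.+1%:R * gam] times the squared norm, strictly below [delta]; hence [n.+2]. *)
pose gam := Num.min c (delta / n.+2%:R).
have gam0 : 0 < gam by rewrite lt_min c0 divr_gt0.
pose eps := Num.min 1 (gam / B).
have eps0 : 0 < eps by rewrite lt_min ltr01 divr_gt0.
have [|E [Es Esupp EB AEh]] := pert eps; first by rewrite eps0 ge_min lexx.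
have Egam u v : `|E u v| <= gam.
  by apply: le_trans (EB u v) _; rewrite -ler_pdivlMr // ge_min lexx orbT.
set h := f + eps *: f1 in AEh.
have hg v : (0 < h v 0) = (0 < g v) /\ (h v 0 < 0) = (g v < 0).
  have [_ gp gn] := gf v; rewrite !mxE; case: (ltgtP (f v 0) 0) => fv.
  - have gv := gn fv; rewrite mulr0 addr0; split; last by rewrite fv gv.
    by rewrite !ltNge !ltW.
  - have gv := gp fv; rewrite mulr0 addr0; split; first by rewrite fv gv.
    by rewrite !ltNge !ltW.
  - by rewrite fv add0r pmulr_rgt0 // pmulr_rlt0.
have h0 v : h v 0 != 0.
  by have [g0 _ _] := gf v; rewrite neq_lt (proj2 (hg v)) (proj1 (hg v)) -neq_lt.
have -> : SND G g = SND G (cfun h).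
  rewrite /SND /strong_nodal_domains; congr #|components _ _ :|: components _ _|;
    by apply/setP => v; have [h_gt0 h_lt0] := hg v; rewrite !inE /cfun ?h_gt0 ?h_lt0.
have AEsupp : supported G (A + E).
  move=> u v; rewrite !mxE; case: (eqVneq u v) => //= uv.
  rewrite mulr0n subr0; case uvG: (G u v) => //.
  have [->|/Msupp] := eqVneq (M u v) 0; last by rewrite (negPf uv) uvG.
  by rewrite add0r => /Esupp; rewrite (negPf uv) uvG.
have AE_le0 u v : u != v -> (A + E) u v <= 0.
  move=> uv; have [->//|/AEsupp] := eqVneq ((A + E) u v) 0; rewrite (negPf uv) /= => uvG.
  rewrite !mxE (negPf uv) mulr0n subr0 -lerBrDl sub0r.
  apply: le_trans (ler_norm _) _; apply: le_trans (Egam u v) _.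
  by rewrite ge_min (cM (u, v)).
have AEs : (A + E)^T = A + E by rewrite !linearD linearN /= Ms tr_scalar_mx Es.
have [H freeH H_le0] := nodal_domains_nonpos AEs AE_le0 AEsupp AEh h0.
rewrite -mE leqNgt; apply/negP => ltm.
(* [H *m Q] has more rows than columns, so some nonzero combination of the domain restrictions is
   killed by [Q]; there the gap contradicts nonpositivity. *)
have /rowV0Pn[a aHQ a0] : kermx (H *m Q) != 0.
  by rewrite kermx_eq0 /row_free neq_ltn (leq_ltn_trans (rank_leq_col _)).
pose x := a *m H.
have x0 : x != 0.
  by apply: contra a0 => /eqP xE; apply/eqP/(row_free_inj freeH); rewrite mul0mx.
have xQ : x *m Q = 0 by rewrite -mulmxA; apply/sub_kermxP.
have := gap x xQ; have := H_le0 a; rewrite -/x !qformD.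
have -> : qform (- l%:M) x = - (l * qform 1%:M x).
  by rewrite -raddfN qform_scalar mulNr.
have q0 := qform1_gt0 x0; have := qform_abs_le x Egam; rewrite ler_norml.
move=> /andP[Eq _] AEq Mq.
have : n.+1%:R * gam < delta.
  have gd : gam <= delta / n.+2%:R by rewrite ge_min lexx orbT.
  rewrite (lt_le_trans _ (_ : n.+2%:R * gam <= _)) ?ltr_pM2r ?ltr_nat //.
  by rewrite mulrC -ler_pdivlMr.
by rewrite -(ltr_pM2r q0); lra.
Qed.

Theorem theorem2p9 (R : realType) (n : nat) (G : sgraph 'I_n)
    (Gconn : connected G) (M : 'M[R]_n) (HM : generalized_laplacian G M)
    (lam : n.-tuple R) (Hlam : ordered_eigenvalues M lam)
    (k : nat) (Hk : (0 < k <= n)%N)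
    (Hsimple : count_mem (lam`_k.-1) lam = 1%N)
    (f : 'cV[R]_n) (f_neq0 : f != 0) (Hf : M *m f = lam`_k.-1 *: f)
    (HU : Urschel (cfun f) != set0)
    (Hshallow : forall v, v \in Urschel (cfun f) -> shallow G (cfun f) v) :
  [/\ forall f1 : 'cV[R]_n,
        (forall v, v \notin Urschel (cfun f) -> f1 v 0 = 0) ->
        exists M1 : 'M[R]_n,
          supported G M1 /\ f1 = mpinv (M - (lam`_k.-1)%:M) *m M1 *m f,
      forall s : 'I_n -> R, (forall v, s v \in [:: -1; 0; 1]) ->
        exists (f1 : 'cV[R]_n) (M1 : 'M[R]_n),
          [/\ forall v, v \notin Urschel (cfun f) -> f1 v 0 = 0,
              forall v, v \in Urschel (cfun f) -> Num.sg (f1 v 0) = s v,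
              supported G M1
            & f1 = mpinv (M - (lam`_k.-1)%:M) *m M1 *m f]
    & (UNmax G (cfun f) <= k)%N].
Proof.
case: n => [|n] in G Gconn M HM lam Hlam Hk Hsimple f f_neq0 Hf HU Hshallow *.
  by case: k Hk {Hsimple Hf}.
have [Ms _ _] := HM; have [lam_sorted Mlam] := Hlam.
set l := lam`_k.-1 in Hsimple Hf *.
have part1 (f1 : 'cV[R]_n.+1) :
    (forall v, v \notin Urschel (cfun f) -> f1 v 0 = 0) ->
    exists M1 : 'M[R]_n.+1, supported G M1 /\ f1 = mpinv (M - l%:M) *m M1 *m f.
  move=> f10; have [M1 M1s M1f] := supported_mul ((M - l%:M) *m f1) Hshallow.
  exists M1; split => //; rewrite -mulmxA M1f (@mpinv_mulK _ _ _ f) //.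
  - by rewrite mulmxBl Hf mul_scalar_mx subrr.
  - move=> y; rewrite mulmxBl mul_scalar_mx => /eqP; rewrite subr_eq0 => /eqP My.
    exact: simple_eigenvector Ms Mlam Hsimple f_neq0 Hf My.
  (* [f] and [f1] have disjoint supports, hence are orthogonal. *)
  apply/matrixP => i j; rewrite !ord1 [RHS]mxE mxE; apply: big1 => v _; rewrite mxE.
  have [fv|/f10 ->] := boolP (v \in Urschel (cfun f)); last by rewrite mulr0.
  by move: fv; rewrite inE => /eqP fv; rewrite (fv : f v 0 = 0) mul0r.
split => // [s s_sign|].
  pose f1 := \col_v if v \in Urschel (cfun f) then s v else 0.
  have f10 v : v \notin Urschel (cfun f) -> f1 v 0 = 0 by rewrite mxE => /negPf ->.
  have [M1 [M1s M1f]] := part1 f1 f10; exists f1, M1; split => // v vU.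
  rewrite mxE vU; have := s_sign v; rewrite !inE.
  by case/or3P => /eqP ->; rewrite ?sgrN ?sgr0 ?sgr1.
rewrite /UNmax; case: ex_maxnP => m /asboolP[g gf <-] _.
apply: leq_trans (signing_SND_le HM Mlam Hf Hshallow gf) _.
by apply: count_le_simple => //; rewrite size_tuple.
Qed.
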